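(* Let $(X,A_\tau,P)$ be a fully probabilistic transition system and let $\alpha:X\to\mathcal G(\mathrm{Path}_\sim X)$ be the induced coalgebra (defined in the context). Two states $x,x'\in X$ are probabilistic delay bisimilar if and only if they are $\mathcal G\circ\mathrm{Path}_\sim$-behaviourally equivalent, i.e. there exist a measurable space $Y$, a measurable map $\beta:Y\to\mathcal G(\mathrm{Path}_\sim Y)$ and a measurable map $f:X\to Y$ with $\mathcal G(\mathrm{Path}_\sim f)\circ\alpha=\beta\circ f$ and $f(x)=f(x')$.
   Context: Fix a set $A$ of actions, $\tau\notin A$, $A_\tau=A\cup\{\tau\}$; $A_\tau^*$ finite words, $\epsilon$ the empty word, ${\downarrow}\sigma$ the set of prefixes of $\sigma$. A path on a set $X$ is a function $p$ into $X$ whose domain is ${\downarrow}\sigma$ for some $\sigma\in A_\tau^*$; $\mathrm{Path}(X)$ is the set of paths; $\mathrm{trace}(p)=\max\mathrm{dom}\,p$, $\mathrm{last}(p)=p(\mathrm{trace}(p))$; $\langle x\rangle$ is the path with domain $\{\epsilon\}$ and value $x$. Paths are ordered by $p\preceq q$ iff $\mathrm{dom}\,p\subseteq\mathrm{dom}\,q$ and $q(\sigma)=p(\sigma)$ for $\sigma\in\mathrm{dom}\,p$; ${\uparrow}p=\{q\mid p\preceq q\}$. The stutter basis of $p$ is the unique $\phi:\mathrm{dom}\,p\to A_\tau^*$ with $\phi(\epsilon)=\epsilon$, $\phi(\sigma'\tau)=\phi(\sigma')$ if $p(\sigma'\tau)=p(\sigma')$, $\phi(\sigma'\tau)=\phi(\sigma')\tau$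 if $p(\sigma'\tau)\neq p(\sigma')$, $\phi(\sigma'a)=\phi(\sigma')a$ for $a\in A$; $\mathrm{st}(p)$ is the path with domain $\phi(\mathrm{dom}\,p)$ with $\mathrm{st}(p)\circ\phi=p$. $p\sim q$ iff $\mathrm{st}(p)=\mathrm{st}(q)$; $\mathrm{Path}_\sim(X)$ is the quotient, $\pi_X$ the quotient map, $\mathrm{Path}_\sim f[p]=[f\circ p]$, ordered by $[p]\preceq[q]$ iff $\mathrm{st}(p)\preceq\mathrm{st}(q)$. Both $\mathrm{Path}(X)$ and $\mathrm{Path}_\sim(X)$ carry the Alexandroff topology (open sets = upward closed sets) and the Borel $\sigma$-algebra of it; this makes $\mathrm{Path}_\sim$ an endofunctor on measurable spaces (independently of the $\sigma$-algebra of $X$). $\mathcal G$ is the Giry functor: $\mathcal G(X,\Sigma_X)$ is the set of probability measures on $(X,\Sigma_X)$ with the smallest $\sigma$-algebra making all evaluations $\mu\mapsto\mu(U)$, $U\in\Sigma_X$, measurable; $\mathcal G(f)(\mu)=\mu\circ f^{-1}$. A fully probabilistic transition system is $(X,A_\tau,P)$ with $X$, $A_\tau$ countable and $P:X\times A_\tau\times X\to[0,1]$ such that for every $x$ the set $\{(a,x')\mid P(x,a,x')>0\}$ is finite and $\sum_{(a,x')}P(x,a,x')\in\{0,1\}$; $X$ has the discrete $\sigma$-algebra. An execution from $x$ is a path $p$ with $p(\epsilon)=x$ and $P(p(\sigma),a,p(\sigma a))>0$ for all $\sigma a\in\mathrm{dom}\,p$; $\mathrm{exec}(x)$ is the set of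 these. $\mu_P(p)=\prod_{\sigma a\in\mathrm{dom}\,p}P(p(\sigma),a,p(\sigma a))$ if $p$ is an execution from some state, else $0$; for a set $U$ of paths $\mu_P(U)=\sum_{p\in U}\mu_P(p)$ (arbitrary sums = supremum of finite subsums). For $U\subseteq\mathrm{Path}(X)$, $U^\star=\{p\in U\mid {\downarrow}p\cap U=\{p\}\}$ where ${\downarrow}p=\{q\mid q\preceq p\}$. Let $\tilde\mu_P$ be the unique measure on the Borel $\sigma$-algebra of $\mathrm{Path}(X)$ with $\tilde\mu_P(U)=\mu_P(U^\star)$ for all open $U$. The coalgebra is $\alpha(x)(U)=\tilde\mu_P(\pi_X^{-1}(U)\cap{\uparrow}\langle x\rangle)$ for measurable $U\subseteq\mathrm{Path}_\sim(X)$. For $L\subseteq A_\tau^*$, $Z\subseteq X$: $x\xrightarrow{L}Z=\{p\in\mathrm{exec}(x)\mid \mathrm{trace}(p)\in L,\ \mathrm{last}(p)\in Z,\ \text{and for all } q\prec p \text{ with } \mathrm{trace}(q)\in L,\ \mathrm{last}(q)\notin Z\}$ and $P(x,L,Z)=\sum_{p\in x\xrightarrow{L}Z}\mu_P(p)$. Let $\hat a=\epsilon$ if $a=\tau$ and $\hat a=a$ otherwise. An equivalence relation $R$ on $X$ is a probabilistic delay bisimulation if $xRx'$ implies $P(x,\tau^*\hat a,[x'']_R)=P(x',\tau^*\hat a,[x'']_R)$ for all $x''\in X$, $a\in A_\tau$. Two states are probabilistic delay bisimilar if some such $R$ relates them.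
   Formalization: The theorem assumes that the measure on Path(X) defining the coalgebra exists; it does not for every system (e.g. one state with a τ-loop of probability 1, as paths are finite), so only systems for which the induced coalgebra is defined are covered. *)

(* Defs.v *)
From HB Require Import structures.
From mathcomp Require Import all_boot all_order all_algebra generic_quotient.
From mathcomp Require Import all_classical all_reals all_analysis.

Set Implicit Arguments.
Unset Strict Implicit.
Unset Printing Implicit Defensive.
Import Order.TTheory GRing.Theory Num.Theory.

Local Open Scope classical_set_scope.
Local Open Scope ring_scope.
Local Open Scope quotient_scope.

(* A_tau is [option A], with [None] the internal action. *)
Notation tau := None (only parsing).
Notation word A := (seq (option A)).

(* A function into X with domain the prefixes of [trace].  [path_val] is total:
   outside the domain it is forced to take the value at the empty word, so that
   Leibniz equality of paths is equality of the functions on their domains. *)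
Record path (A X : choiceType) := Path {
  trace : word A;
  path_val :> word A -> X;
  path_junk : forall s, ~~ prefix s trace -> path_val s = path_val [::] }.
Arguments Path {A X}.

Definition dom (A X : choiceType) (p : path A X) : set (word A) :=
  [set s | prefix s (trace p)].

Definition last_state (A X : choiceType) (p : path A X) : X := p (trace p).

Definition path_le (A X : choiceType) (p q : path A X) : Prop :=
  dom p `<=` dom q /\ forall s, dom p s -> q s = p s.

Definition up (A X : choiceType) (p : path A X) : set (path A X) :=
  [set q | path_le p q].

Definition down (A X : choiceType) (p : path A X) : set (path A X) :=
  [set q | path_le q p].

Definition path1 (A X : choiceType) (x : X) : path A X :=
  Path [::] (fun=> x) (fun _ _ => erefl).

Lemma path_map_junk (A X Y : choiceType) (f : X -> Y) (p : path A X) s :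
  ~~ prefix s (trace p) -> (f \o p) s = (f \o p) [::].
Proof. by move=> /path_junk /= ->. Qed.

Definition path_map (A X Y : choiceType) (f : X -> Y) (p : path A X) :
  path A Y := Path (trace p) (f \o p) (path_map_junk f (p := p)).

Lemma path_mapE (A X Y : choiceType) (f : X -> Y) (p : path A X) s :
  path_map f p s = f (p s).
Proof. by []. Qed.

Lemma path_ext (A X : choiceType) (p q : path A X) :
  trace p = trace q -> (forall s, dom p s -> p s = q s) -> p = q.
Proof.
case: p q => t p jp [t' q jq] /= tt'; rewrite -{}tt' in jq *.
rewrite /dom/= => pq; have {}pq : p = q.
  apply/funext => s; have [st|st] := boolP (prefix s t); first exact: pq.
  by rewrite jp// jq//; apply: pq => /=; rewrite prefix0s.
by rewrite -{}pq in jq *; congr Path; exact: Prop_irrelevance.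
Qed.

(* The argument is the reversed word, so that the recursion strips the last
   action. *)
Fixpoint stutter_basis_rev (A X : choiceType) (p : path A X) (r : word A) :
    word A :=
  if r is a :: r' then
    if (a == tau) && (p (rcons (rev r') a) == p (rev r'))
    then stutter_basis_rev p r'
    else rcons (stutter_basis_rev p r') a
  else [::].

Definition stutter_basis (A X : choiceType) (p : path A X) (s : word A) :
  word A := stutter_basis_rev p (rev s).

Section stutter.
Variables (A X : choiceType).
Implicit Types (p q : path A X) (s t w : word A).

Lemma stutter_basis_nil p : stutter_basis p [::] = [::].
Proof. by []. Qed.

Lemma stutter_basis_rcons p s a : stutter_basis p (rcons s a) =
  if (a == tau) && (p (rcons s a) == p s) then stutter_basis p s
  else rcons (stutter_basis p s) a.
Proof. by rewrite /stutter_basis rev_rcons /= revK. Qed.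

Lemma dom_nil p : dom p [::].
Proof. by rewrite /dom/= prefix0s. Qed.

Lemma dom_trace p : dom p (trace p).
Proof. by rewrite /dom/= prefix_refl. Qed.

Lemma dom_rcons p s a : dom p (rcons s a) -> dom p s.
Proof. by rewrite /dom/= -cats1; exact: catl_prefix. Qed.

Lemma stutter_basis_cat p s u :
  prefix (stutter_basis p s) (stutter_basis p (s ++ u)) /\
  (stutter_basis p (s ++ u) = stutter_basis p s -> p (s ++ u) = p s).
Proof.
elim/last_ind: u => [|u a [IH1 IH2]]; first by rewrite cats0 prefix_refl.
rewrite -rcons_cat stutter_basis_rcons; case: ifPn => [/andP[_ /eqP ->] //|_].
split; first exact: prefix_trans (prefix_rcons _ _).
move=> e; exfalso; move/size_prefix: IH1.
by rewrite -[in leqLHS]e size_rcons ltnn.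
Qed.

Lemma prefix_total s t w : prefix s w -> prefix t w ->
  prefix s t \/ prefix t s.
Proof.
move=> /prefixP[u ->]; rewrite prefixE take_cat.
case: ltnP => [st|ts]; first by move=> /eqP <-; right; exact: prefix_take.
by move=> /eqP <-; left; exact: prefix_prefix.
Qed.

Lemma stutter_basis_inj p s t : dom p s -> dom p t ->
  stutter_basis p s = stutter_basis p t -> p s = p t.
Proof.
move=> ds dt e; have [/prefixP[u tE]|/prefixP[u sE]] := prefix_total ds dt.
  by rewrite tE; apply/esym/(stutter_basis_cat p s u).2; rewrite -tE.
by rewrite sE; apply/(stutter_basis_cat p t u).2; rewrite -sE.
Qed.

Lemma stutter_basis_surj p s w : prefix w (stutter_basis p s) ->
  exists2 t, prefix t s & stutter_basis p t = w.
Proof.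
elim/last_ind: s => [|s a IH].
  by rewrite stutter_basis_nil prefixs0 => /eqP ->; exists [::].
have H : prefix w (stutter_basis p s) ->
    exists2 t, prefix t (rcons s a) & stutter_basis p t = w.
  by move=> /IH[t ts tw]; exists t => //; exact: prefix_trans (prefix_rcons _ _).
rewrite stutter_basis_rcons; case: ifPn => // na ws.
have [?|nws] := boolP (prefix w (stutter_basis p s)); first exact: H.
exists (rcons s a); first exact: prefix_refl.
rewrite stutter_basis_rcons (negbTE na).
move/prefixP: ws => [u]; case/lastP: u => [|u b]; first by rewrite cats0.
rewrite -rcons_cat => /rcons_inj[e _]; move: nws.
by rewrite e prefix_prefix.
Qed.

(* On the image of the stutter basis, [p] composed with a section of it;
   [xget] returns the empty word outside that image. *)
Definition stutter_free_val p w : X :=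
  p (xget [::] [set s | dom p s /\ stutter_basis p s = w]).

Lemma stutter_free_valE p s : dom p s ->
  stutter_free_val p (stutter_basis p s) = p s.
Proof.
move=> ds; rewrite /stutter_free_val; case: xgetP => [t _ [dt et]|/(_ s)].
  exact: stutter_basis_inj.
by case.
Qed.

Lemma stutter_free_junk p w : ~~ prefix w (stutter_basis p (trace p)) ->
  stutter_free_val p w = stutter_free_val p [::].
Proof.
move=> nw; rewrite -[in RHS](stutter_basis_nil p).
rewrite (stutter_free_valE (dom_nil p)) /stutter_free_val.
case: xgetP => // t _ [/prefixP[u tu] tw]; move: nw.
by rewrite tu -tw (stutter_basis_cat p t u).1.
Qed.

Definition st p : path A X :=
  Path (stutter_basis p (trace p)) (stutter_free_val p)
       (stutter_free_junk (p := p)).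

Lemma st_dom p : dom (st p) = stutter_basis p @` dom p.
Proof.
apply/seteqP; split => [w|_ [s /prefixP[u su] <-]].
  by move=> /stutter_basis_surj[s sp <-]; exists s.
by rewrite /dom/= su (stutter_basis_cat p s u).1.
Qed.

Lemma st_val p s : dom p s -> st p (stutter_basis p s) = p s.
Proof. exact: stutter_free_valE. Qed.

Lemma st_le p q : path_le p q -> path_le (st p) (st q).
Proof.
move=> [pq qp]; have E s : dom p s -> stutter_basis q s = stutter_basis p s.
  elim/last_ind: s => // s a IH dsa; have ds := dom_rcons dsa.
  by rewrite !stutter_basis_rcons !qp// IH.
split; rewrite !st_dom.
  by move=> _ [s ds <-]; exists s; [exact: pq|exact: E].
by move=> _ [s ds <-]; rewrite st_val// -E// st_val ?qp//; exact: pq.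
Qed.

End stutter.

Lemma st_map (A X Y : choiceType) (f : X -> Y) (p : path A X) :
  st (path_map f p) = st (path_map f (st p)).
Proof.
have E s : dom p s -> stutter_basis (path_map f p) s =
    stutter_basis (path_map f (st p)) (stutter_basis p s).
  elim/last_ind: s => // s a IH dsa; have ds := dom_rcons dsa.
  rewrite !stutter_basis_rcons IH//; have := st_val dsa.
  rewrite stutter_basis_rcons.
  case: ifPn => [/andP[-> /eqP/= e] _|_ va]; first by rewrite e eqxx.
  by rewrite stutter_basis_rcons !path_mapE va (st_val ds).
apply: path_ext => [|w]; first exact: E (dom_trace p).
have D s : dom p s -> dom (path_map f (st p)) (stutter_basis p s).
  by move=> ds; rewrite -[dom _]/(dom (st p)) st_dom; exists s.
rewrite st_dom => -[s ds <-]; rewrite st_val//.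
by rewrite (E s ds) st_val ?path_mapE ?st_val//; exact: D.
Qed.

Section path_instances.
Variables (A X : choiceType).

HB.instance Definition _ := gen_eqMixin (path A X).
HB.instance Definition _ := gen_choiceMixin (path A X).

Definition path_open : set_system (path A X) :=
  [set U | forall p q, U p -> path_le p q -> U q].

Lemma path_openT : path_open setT. Proof. by []. Qed.

Lemma path_openI : setI_closed path_open.
Proof. by move=> U V oU oV p q [Up Vp] pq; split; [exact: oU pq|exact: oV pq]. Qed.

Lemma path_open_bigU (I : Type) (F : I -> set (path A X)) :
  (forall i, path_open (F i)) -> path_open (\bigcup_i F i).
Proof. by move=> oF p q [i _ Fp] pq; exists i => //; exact: oF pq. Qed.

HB.instance Definition _ := isOpenTopological.Build (path A X)
  path_openT path_openI path_open_bigU.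

Lemma path_openE : @open (path A X) = path_open.
Proof. by []. Qed.

Definition stutter_eq (p q : path A X) : bool := st p == st q.

Lemma stutter_eq_equiv : equiv_class_of stutter_eq.
Proof.
by split => [p|p q|q p r]; rewrite /stutter_eq ?eqxx// => /eqP ->.
Qed.

Canonical stutter_equiv : equiv_rel (path A X) :=
  EquivRelPack stutter_eq_equiv.

Definition pathsim := {eq_quot stutter_equiv}.

HB.instance Definition _ := Quotient.on pathsim.
HB.instance Definition _ := Choice.on pathsim.

Definition pathsim_le (c d : pathsim) : Prop :=
  path_le (st (repr c)) (st (repr d)).

Definition pathsim_pi (p : path A X) : pathsim := \pi_pathsim p.

Lemma pathsim_piP p q : pathsim_pi p = pathsim_pi q <-> st p = st q.
Proof.
split=> [/eqP|pq]; last by apply/eqP; rewrite eqmodE /= /stutter_eq pq.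
by rewrite eqmodE /= /stutter_eq => /eqP.
Qed.

Lemma st_repr p : st (repr (pathsim_pi p)) = st p.
Proof. by apply/pathsim_piP; rewrite /pathsim_pi reprK. Qed.

Lemma pathsim_le_pi p q :
  pathsim_le (pathsim_pi p) (pathsim_pi q) <-> path_le (st p) (st q).
Proof. by rewrite /pathsim_le !st_repr. Qed.

Definition pathsim_open : set_system pathsim :=
  [set U | forall c d, U c -> pathsim_le c d -> U d].

Lemma pathsim_openT : pathsim_open setT. Proof. by []. Qed.

Lemma pathsim_openI : setI_closed pathsim_open.
Proof. by move=> U V oU oV p q [Up Vp] pq; split; [exact: oU pq|exact: oV pq]. Qed.

Lemma pathsim_open_bigU (I : Type) (F : I -> set pathsim) :
  (forall i, pathsim_open (F i)) -> pathsim_open (\bigcup_i F i).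
Proof. by move=> oF p q [i _ Fp] pq; exists i => //; exact: oF pq. Qed.

HB.instance Definition _ := isOpenTopological.Build pathsim
  pathsim_openT pathsim_openI pathsim_open_bigU.

Lemma pathsim_openE : @open pathsim = pathsim_open.
Proof. by []. Qed.

End path_instances.

(* measurableType's are pointed, hence the base point on the state space. *)
HB.instance Definition _ (A : choiceType) (X : pointedType) :=
  isPointed.Build (path A X) (path1 A point).
HB.instance Definition _ (A : choiceType) (X : pointedType) :=
  isPointed.Build (pathsim A X) (pathsim_pi (path1 A point)).

Definition borel (T : ptopologicalType) := g_sigma_algebraType (@open T).
HB.instance Definition _ (T : ptopologicalType) := Measurable.on (borel T).

Definition bpath (A : choiceType) (X : pointedType) := borel (path A X).
HB.instance Definition _ (A : choiceType) (X : pointedType) :=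
  Measurable.on (bpath A X).

Definition bpathsim (A : choiceType) (X : pointedType) := borel (pathsim A X).
HB.instance Definition _ (A : choiceType) (X : pointedType) :=
  Measurable.on (bpathsim A X).

Definition discrete (X : pointedType) :=
  g_sigma_algebraType (@discrete_measurable X).
HB.instance Definition _ (X : pointedType) := Measurable.on (discrete X).

Definition pathsim_map (A : choiceType) (X Y : pointedType) (f : X -> Y) :
    bpathsim A X -> bpathsim A Y :=
  fun c => pathsim_pi (path_map f (repr c)).

Section functor.
Variables (A : choiceType) (X Y : pointedType) (f : X -> Y).

Lemma pathsim_map_pi (p : path A X) :
  pathsim_map f (pathsim_pi p) = pathsim_pi (path_map f p).
Proof. by apply/pathsim_piP; rewrite st_map st_repr -st_map. Qed.

Lemma path_map_le (p q : path A X) :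
  path_le p q -> path_le (path_map f p) (path_map f q).
Proof. by move=> [pq qp]; split=> // s ds; rewrite !path_mapE qp. Qed.

Lemma measurable_pathsim_map :
  measurable_fun [set: bpathsim A X] (pathsim_map f).
Proof.
apply: (@measurability _ _ (bpathsim A X) (bpathsim A Y) _ _ (@open (pathsim A Y))) => // _ [U oU <-].
rewrite setTI; apply: sub_sigma_algebra.
rewrite pathsim_openE in oU; suff: pathsim_open (pathsim_map f @^-1` U) by [].
move=> c d /= Uc cd; apply: oU Uc _; apply/pathsim_le_pi; rewrite st_map [st (path_map f (repr d))]st_map.
exact/st_le/path_map_le.
Qed.

Lemma measurable_pathsim_pi :
  measurable_fun [set: bpath A X] (@pathsim_pi A X : _ -> bpathsim A X).
Proof.
apply: (@measurability _ _ (bpath A X) (bpathsim A X) _ _ (@open (pathsim A X))) => // _ [U oU <-].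
rewrite setTI; apply: sub_sigma_algebra.
rewrite pathsim_openE in oU; suff: path_open (@pathsim_pi A X @^-1` U) by [].
by move=> p q /= Up pq; apply: oU Up _; apply/pathsim_le_pi; exact: st_le.
Qed.

End functor.

Record fpts (R : realType) (A X : choiceType) := Fpts {
  fpts_P :> X -> option A -> X -> R;
  fpts_states : countable [set: X];
  fpts_actions : countable [set: option A];
  fpts_ge0 : forall x a y, 0 <= fpts_P x a y;
  fpts_le1 : forall x a y, fpts_P x a y <= 1;
  fpts_finite : forall x,
    finite_set [set t : option A * X | 0 < fpts_P x t.1 t.2];
  fpts_sum : forall x,
    \esum_(t in [set: option A * X]) (fpts_P x t.1 t.2)%:E = 0%E \/
    \esum_(t in [set: option A * X]) (fpts_P x t.1 t.2)%:E = 1%E }.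

Section fpts.
Variables (R : realType) (A X : choiceType) (P : fpts R A X).

Definition exec (x : X) : set (path A X) :=
  [set p : path A X | p [::] = x /\
    forall s a, dom p (rcons s a) -> 0 < P (p s) a (p (rcons s a))].

(* The words s.a in dom p are the prefixes of length i.+1 of trace p. *)
Definition path_weight (p : path A X) : R :=
  if `[< exists x, exec x p >] then
    \prod_(i < size (trace p))
      P (p (take i (trace p))) (nth tau (trace p) i) (p (take i.+1 (trace p)))
  else 0.

Definition set_weight (U : set (path A X)) : \bar R :=
  \esum_(p in U) (path_weight p)%:E.

(* U^* *)
Definition minimal_paths (U : set (path A X)) : set (path A X) :=
  [set p | U p /\ down p `&` U = [set p]].

(* The set of paths written x -L-> Z; its total weight is P(x, L, Z). *)
Definition reach_paths (x : X) (L : set (word A)) (Z : set X) :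
    set (path A X) :=
  [set p | [/\ exec x p, L (trace p), Z (last_state p) &
    forall q, path_le q p -> q <> p -> L (trace q) -> ~ Z (last_state q)]].

Definition reach_prob (x : X) (L : set (word A)) (Z : set X) : \bar R :=
  \esum_(p in reach_paths x L Z) (path_weight p)%:E.

Definition hat (a : option A) : word A := if a == tau then [::] else [:: a].

Definition taus_hat (a : option A) : set (word A) :=
  [set nseq n tau ++ hat a | n in [set: nat]].

Definition delay_bisimulation (r : rel X) : Prop :=
  equivalence_rel r /\
  forall x x', r x x' -> forall (y : X) (a : option A),
    reach_prob x (taus_hat a) [set z | r y z] =
    reach_prob x' (taus_hat a) [set z | r y z].

Definition delay_bisimilar (x x' : X) : Prop :=
  exists2 r : rel X, delay_bisimulation r & r x x'.

End fpts.

(* There is at most one such measure up to its values on non-measurable sets,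
   but there may be none: for one state with a loop of probability 1, the
   up-sets of the executions of length n all have weight 1, decrease with n and
   have empty intersection, as paths are finite.  Hence it is an argument of
   the coalgebra below rather than a construction. *)
Definition is_path_measure (R : realType) (A : choiceType) (X : pointedType)
    (P : fpts R A X) (mu : {measure set (bpath A X) -> \bar R}) : Prop :=
  forall U : set (path A X), open U -> mu U = set_weight P (minimal_paths U).

Section coalgebra.
Local Open Scope ereal_scope.
Variables (R : realType) (A : choiceType) (X : pointedType) (P : fpts R A X).
Variable mu : {measure set (bpath A X) -> \bar R}.
Hypothesis muP : is_path_measure P mu.
Variable x : X.

Lemma path_le_refl (p : path A X) : path_le p p.
Proof. by split. Qed.

Lemma path_le_trans (p q r : path A X) :
  path_le p q -> path_le q r -> path_le p r.
Proof.
move=> [pq qp] [qr rq]; split=> [s /pq /qr //|s ds].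
by rewrite rq ?qp//; exact: pq.
Qed.

Lemma open_up (p : path A X) : open (up p).
Proof. by rewrite path_openE => q r; exact: path_le_trans. Qed.

Lemma measurable_up (p : path A X) : measurable (up p : set (bpath A X)).
Proof. by apply: sub_sigma_algebra; exact: open_up. Qed.

Lemma path_le_anti (p q : path A X) : path_le p q -> path_le q p -> p = q.
Proof.
move=> [pq qp] [qp' _]; apply: path_ext => [|s ds]; last by rewrite qp.
have /prefixP[u qE] := pq _ (dom_trace p).
have /size_prefix := qp' _ (dom_trace q).
by rewrite qE size_cat -[leqRHS]addn0 leq_add2l leqn0 => /nilP ->; rewrite cats0.
Qed.

Lemma minimal_paths_up (p : path A X) : minimal_paths (up p) = [set p].
Proof.
apply/seteqP; split=> [q [pq /seteqP[+ _]]|_ ->].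
  by move=> /(_ p) H; apply/esym/H; split=> //; exact: path_le_refl.
split; first exact: path_le_refl.
apply/seteqP; split=> [q [qp pq]|_ ->]; first exact: path_le_anti.
by split; exact: path_le_refl.
Qed.

Definition alpha_val (U : set (bpathsim A X)) : \bar R :=
  mu ((@pathsim_pi A X) @^-1` U `&` up (path1 A x)).

Let alpha_meas (U : set (bpathsim A X)) : measurable U ->
  measurable ((@pathsim_pi A X) @^-1` U `&` up (path1 A x) : set (bpath A X)).
Proof.
move=> mU; apply: measurableI; last exact: measurable_up.
rewrite -[X in measurable X]setTI.
exact: (measurable_pathsim_pi measurableT).
Qed.

Let alpha0 : alpha_val set0 = 0.
Proof. by rewrite /alpha_val preimage_set0 set0I measure0. Qed.

Let alpha_ge0 U : 0 <= alpha_val U.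
Proof. exact: measure_ge0. Qed.

Let alpha_sigma_additive : semi_sigma_additive alpha_val.
Proof.
move=> F mF tF mUF; rewrite /alpha_val preimage_bigcup setI_bigcupl.
apply: measure_semi_sigma_additive.
- by move=> n; exact: alpha_meas.
- apply/trivIsetP => /= i j _ _ ij; rewrite setIACA setIid -preimage_setI.
  by move/trivIsetP : tF => /(_ _ _ _ _ ij) ->//; rewrite preimage_set0 set0I.
- by rewrite -setI_bigcupl -preimage_bigcup; exact: alpha_meas.
Qed.

HB.instance Definition _ := isMeasure.Build _ _ _ alpha_val
  alpha0 alpha_ge0 alpha_sigma_additive.

Let alpha_setT : alpha_val setT = 1.
Proof.
rewrite /alpha_val preimage_setT setTI muP ?minimal_paths_up; last exact: open_up.
rewrite /set_weight esum_set1 /path_weight ?big_ord0; last by case: asboolP.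
case: asboolP => // -[]; exists x; split=> // s a.
by move=> /size_prefix; rewrite size_rcons.
Qed.

HB.instance Definition _ :=
  Measure_isProbability.Build _ _ _ alpha_val alpha_setT.

Definition alpha : pprobability (bpathsim A X) R := alpha_val.

End coalgebra.

(* Equality of measures is agreement on the measurable sets, as in the library
   a measure also assigns (irrelevant) values to the other sets. *)
Definition behav_equiv (R : realType) (A : choiceType) (d : measure_display)
    (X : measurableType d) (al : X -> pprobability (bpathsim A X) R)
    (x x' : X) : Prop :=
  exists (d' : measure_display) (Y : measurableType d')
      (beta : Y -> pprobability (bpathsim A Y) R) (f : X -> Y),
    [/\ measurable_fun [set: Y] beta,
        measurable_fun [set: X] f,
        forall (z : X) (U : set (bpathsim A Y)), measurable U ->
          pushforward (al z) (pathsim_map f) U = beta (f z) U &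
        f x = f x'].

(* Main.v *)
(* If f is a coalgebra morphism, reaching a class of ker f by a word of tau^* a
   is the inverse image of an open set of stutter classes of paths over Y, so
   ker f is a delay bisimulation.

   Conversely let r be a delay bisimulation and k x the representative of the
   class of x.  Weights of open sets of paths satisfy a one-step equation, and
   bounded functions dominated by their one-step mean vanish, because the
   existence of the path measure forces termination.  For a finite list of
   classes the matrix of tau^*-hitting probabilities h_D(E) is invertible: a
   combination of the h_D vanishing on the list vanishes everywhere, and its
   one-step defect at D is the coefficient of h_D times a probability of never
   returning.  Hence the equations
     h_D(C) (1 - P(x,tau,C)) = sum_(E <> C) P(x,tau,E) h_D(E)   (x in C <> D)
   determine P(x,tau,E) / (1 - P(x,tau,C)), so that states of one class leave it
   in the same proportions.  By induction on a stutter-free path q over the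
   quotient, the probability that the stutter-reduced image of a path extends q
   depends only on the class of the initial state; the sets of extensions form a
   countable pi-system generating the Borel sets, so k is a coalgebra morphism
   onto the discrete quotient. *)
Require Import Defs.
From HB Require Import structures.
From mathcomp Require Import all_boot all_order all_algebra.
From mathcomp Require Import all_classical all_reals all_analysis.
From mathcomp Require Import finmap ring.
(* [path], [path_le] and others are hidden by mathcomp's path.v. *)
Import Defs.

Set Implicit Arguments.
Unset Strict Implicit.
Unset Printing Implicit Defensive.
Import Order.TTheory GRing.Theory Num.Theory.
Import numFieldNormedType.Exports.

Local Open Scope classical_set_scope.
Local Open Scope ring_scope.

(** * Prepending a transition to a path *)

Section path_cons.
Variables (A : choiceType) (X : pointedType).
Implicit Types (p q : path A X) (x y : X) (a b : option A).

Lemma dom_path1 (x : X) (s : word A) : dom (path1 A x) s -> s = [::].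
Proof. by case: s. Qed.

Lemma pcons_junk x a p s : ~~ prefix s (a :: trace p) ->
  (fun s => if s is b :: s' then
     if (b == a) && prefix s' (trace p) then p s' else x else x) s = x.
Proof. by case: s => //= b s; case: eqP => //= _ /negbTE ->. Qed.

(** The value [x] off the domain is the one that [path_junk] prescribes: the value at the empty
    word. *)
Definition pcons x a p : path A X := Path (a :: trace p)
  (fun s => if s is b :: s' then
     if (b == a) && prefix s' (trace p) then p s' else x else x)
  (@pcons_junk x a p).

Lemma pcons_cons x a p s : prefix s (trace p) -> pcons x a p (a :: s) = p s.
Proof. by rewrite /= eqxx => ->. Qed.

Lemma last_state_pcons x a p : last_state (pcons x a p) = last_state p.
Proof. by rewrite /last_state pcons_cons// prefix_refl. Qed.

Lemma ptail_junk p a s u : ~~ prefix u s ->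
  (fun u => if prefix u s then p (a :: u) else p [:: a]) u =
  (fun u => if prefix u s then p (a :: u) else p [:: a]) [::].
Proof. by move=> /= /negbTE ->; case: ifP. Qed.

Definition ptail p a s : path A X :=
  Path s (fun u => if prefix u s then p (a :: u) else p [:: a])
    (@ptail_junk p a s).

Lemma pcons_ptail p a s : trace p = a :: s ->
  p = pcons (p [::]) a (ptail p a s).
Proof.
move=> tp; apply: path_ext => //; rewrite /dom tp => -[|b u] //=.
by case: eqP => //= -> us; rewrite us.
Qed.

Lemma path1E p : trace p = [::] -> p = path1 A (p [::]).
Proof.
move=> tp; apply: path_ext => // s.
by rewrite /dom/= tp; case: s.
Qed.

(** Induction from the front, the direction in which one-step equations unfold; the stutter basis,
    by contrast, is recursive at the last action. *)
Lemma path_cons_ind (T : path A X -> Prop) :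
  (forall x, T (path1 A x)) -> (forall x a p, T p -> T (pcons x a p)) ->
  forall p, T p.
Proof.
move=> T1 TS p; have [n] := ubnP (size (trace p)).
elim: n p => // n IH p; case tp : (trace p) => [|a s].
  by move=> _; rewrite (path1E tp); exact: T1.
by rewrite (pcons_ptail tp) => sn; apply/TS/IH.
Qed.

Lemma path_le_path1 x p : path_le (path1 A x) p <-> p [::] = x.
Proof.
split=> [[_ /(_ [::])]|px]; first exact.
by split=> s /dom_path1 ->; rewrite ?px//; exact: dom_nil.
Qed.

Lemma pcons_le_path1 x a p y : ~ path_le (pcons x a p) (path1 A y).
Proof. by move=> [/(_ _ (dom_trace _))]. Qed.

Lemma path_le_pcons x a p y b q :
  path_le (pcons x a p) (pcons y b q) <-> [/\ x = y, a = b & path_le p q].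
Proof.
split=> [[pq qp]|[-> -> [pq qp]]]; last first.
  split=> -[|c s]; rewrite /dom //=.
    by case: eqP => //= _ /pq.
  by case: eqP => //= _ sp; rewrite sp pq// qp.
have /= xy := qp _ (dom_nil _); have /= := pq _ (dom_trace _).
rewrite /dom/=; case: eqP => //= ab _; subst b; rewrite xy.
split=> //; split=> s ds.
  by have := pq (a :: s); rewrite /dom/= eqxx; apply.
have das : dom (pcons x a p) (a :: s) by rewrite /dom/= eqxx.
have := qp _ das; rewrite pcons_cons ?pcons_cons//.
by have := pq _ das; rewrite /dom/= eqxx.
Qed.

Lemma pcons_inj x a p y b q :
  pcons x a p = pcons y b q -> [/\ x = y, a = b & p = q].
Proof.
move=> e; have /path_le_pcons[-> -> pq] : path_le (pcons x a p) (pcons y b q).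
  by rewrite e; exact: path_le_refl.
have /path_le_pcons[_ _ qp] : path_le (pcons y b q) (pcons x a p).
  by rewrite e; exact: path_le_refl.
by split=> //; exact: path_le_anti.
Qed.

Lemma st_path1 x : st (path1 A x) = path1 A x.
Proof.
by apply: path_ext => // s /dom_path1 ->.
Qed.

Lemma st_nil p : st p [::] = p [::].
Proof. exact: (st_val (dom_nil p)). Qed.

(** The first transition contributes its letter unless it is a silent step without change of state;
    every later letter compares the same two states as in [p]. *)
Lemma stutter_basis_pcons x a p s : prefix s (trace p) ->
  stutter_basis (pcons x a p) (a :: s) =
  (if (a == None) && (p [::] == x) then [::] else [:: a]) ++ stutter_basis p s.
Proof.
elim/last_ind: s => [_|s c IH dsc].
  rewrite -[[:: a]]/(rcons [::] a) stutter_basis_rcons pcons_cons ?prefix0s//.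
  by rewrite /= stutter_basis_nil cats0.
have ds : prefix s (trace p) by exact: dom_rcons dsc.
rewrite -rcons_cons stutter_basis_rcons rcons_cons !pcons_cons// IH//.
by rewrite stutter_basis_rcons; case: ifP => //; rewrite rcons_cat.
Qed.

Lemma st_pcons x a p : st (pcons x a p) =
  if (a == None) && (p [::] == x) then st p else pcons x a (st p).
Proof.
have T := stutter_basis_pcons x a (prefix_refl (trace p)).
apply: path_ext; first by rewrite /= T; case: ifP.
rewrite st_dom => _ [[|b s] ds <-].
  rewrite stutter_basis_nil st_nil.
  by case: ifP => // /andP[_ /eqP <-]; rewrite st_nil.
have /andP[/eqP ab sp] : (b == a) && prefix s (trace p) by [].
subst b; rewrite st_val// pcons_cons// stutter_basis_pcons//.
case: ifP => _; first by rewrite cat0s st_val.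
rewrite cat1s pcons_cons ?st_val//.
by have : dom (st p) (stutter_basis p s) by rewrite st_dom; exists s.
Qed.

End path_cons.

Lemma path_map_path1 (A : choiceType) (X Y : pointedType) (f : X -> Y) x :
  path_map f (path1 A x) = path1 A (f x).
Proof. exact: path_ext. Qed.

Lemma path_map_pcons (A : choiceType) (X Y : pointedType) (f : X -> Y)
    x a (p : path A X) :
  path_map f (pcons x a p) = pcons (f x) a (path_map f p).
Proof. by apply: path_ext => // -[|b s] //= _; case: ifP. Qed.

(** * The event of reaching a set by a word of [taus_hat a] *)

Section hits.
Variable A : choiceType.
Implicit Types (X Y : pointedType).

(** Unlike [reach_paths], an upward closed set; its minimal elements that are executions from a
    given state are the reaching paths. *)
Definition hits X (a : option A) (Z : set X) : set (path A X) :=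
  [set p | exists s, [/\ prefix s (trace p), taus_hat a s & Z (p s)]].

Lemma taus_hat_nil (a : option A) : taus_hat a [::] <-> a = None.
Proof.
split=> [[[|n] _]|->]; rewrite /hat; [|by []|by exists 0%N].
by case: eqP.
Qed.

Lemma taus_hat_cons (a b : option A) s :
  taus_hat a (b :: s) <->
  (b = None /\ taus_hat a s) \/ [/\ a <> None, b = a & s = [::]].
Proof.
split=> [[[|n] _]|[[-> [n _ <-]]|[aN -> ->]]] /=.
- by rewrite /hat; case: eqP => //= aN [<- <-]; right.
- by move=> [<- <-]; left; split=> //; exists n.
- by exists n.+1.
- by exists 0%N => //=; rewrite /hat; case: eqP.
Qed.

Lemma hits_path1 X a (Z : set X) x : hits a Z (path1 A x) <-> a = None /\ Z x.
Proof.
split=> [[s []]|[-> Zx]]; last by exists [::]; split=> //; apply/taus_hat_nil.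
by rewrite prefixs0 => /eqP -> /taus_hat_nil.
Qed.

Lemma hits_pcons X a (Z : set X) x b p : hits a Z (pcons x b p) <->
  [\/ a = None /\ Z x, b = None /\ hits a Z p |
      [/\ a <> None, b = a & Z (p [::])]].
Proof.
split=> [[[|c s]]|].
- by case=> _ /taus_hat_nil -> /= Zx; apply: Or31.
- case=> /= /andP[/eqP -> sp]; rewrite eqxx sp /=.
  move=> /taus_hat_cons[[-> La]|[aN -> ->]] Z'; last by apply: Or33.
  by apply: Or32; split=> //; exists s.
case=> [[-> Zx]|[-> [s [sp La Zs]]]|[aN -> Zp]].
- by exists [::]; split=> //; apply/taus_hat_nil.
- exists (None :: s); split; rewrite /= ?eqxx// ?sp//.
  by apply/taus_hat_cons; left.
- exists [:: a]; split; rewrite /= ?eqxx ?prefix0s//.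
  by apply/taus_hat_cons; right.
Qed.

(** Erasing a stutter step drops one silent action and no visited state, so words of [taus_hat a]
    remain such. Hence the event is a union of stutter classes. *)
Lemma hits_st X a (Z : set X) p : hits a Z (st p) <-> hits a Z p.
Proof.
elim/path_cons_ind: p => [x|x b p IH]; first by rewrite st_path1.
rewrite st_pcons; case: ifPn => [/andP[/eqP -> /eqP <-]|_].
  rewrite IH hits_pcons; split=> [?|]; first by apply: Or32.
  case=> [[-> Zp]|[]//|[aN]]; last by move/esym.
  by exists [::]; split; [exact: prefix0s|exact/taus_hat_nil|].
rewrite !hits_pcons st_nil.
by split=> -[?|[? /IH ?]|?]; [apply: Or31|apply: Or32|apply: Or33|
                              apply: Or31|apply: Or32|apply: Or33].
Qed.

Lemma hits_map X Y (f : X -> Y) a Z (p : path A X) :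
  hits a Z (path_map f p) <-> hits a (f @^-1` Z) p.
Proof. by []. Qed.

Lemma hits_le X a (Z : set X) p q : hits a Z p -> path_le p q -> hits a Z q.
Proof.
move=> [s [sp La Zs]] [pq qp]; exists s; split=> //; first exact: pq.
by rewrite qp.
Qed.

End hits.

(** * Weights of sets of paths and their one-step equations *)

Lemma esumZl (R : realType) (T : choiceType) (D : set T) (c : R)
    (f : T -> \bar R) : 0 <= c -> (forall t, 0%E <= f t)%E ->
  (\esum_(t in D) (c%:E * f t) = c%:E * \esum_(t in D) f t)%E.
Proof.
move=> c0 f0; have le d (g : T -> \bar R) : 0 <= d ->
      (forall t, 0%E <= g t)%E ->
    (\esum_(t in D) (d%:E * g t) <= d%:E * \esum_(t in D) g t)%E.
  move=> d0 g0; apply: ge_ereal_sup => _ [F [finF FD] <-].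
  rewrite -ge0_mule_fsumr//; apply: lee_wpmul2l; first by rewrite lee_fin.
  by apply: ereal_sup_ubound; exists F.
have [->|cN0] := eqVneq c 0.
  by rewrite mul0e esum1// => t _; rewrite mul0e.
have c_gt0 : 0 < c by rewrite lt_neqAle eq_sym cN0.
apply/eqP; rewrite eq_le le//=.
have cf0 t : (0%E <= c%:E * f t)%E by rewrite mule_ge0// lee_fin.
(* The converse inequality is [le] again, for the factor [c^-1] and the family [c%:E * f t]. *)
rewrite -[leRHS]mul1e -(divff cN0) EFinM -muleA lee_pmul2l ?lte_fin//.
apply: le_trans (le c^-1 (fun t => c%:E * f t)%E _ cf0).
  by apply: le_esum => t _; rewrite muleA -EFinM mulVf// mul1e.
by rewrite invr_ge0.
Qed.

Lemma minimal_pathsE (A : choiceType) (X : pointedType) (U : set (path A X)) p :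
  minimal_paths U p <-> U p /\ forall q, path_le q p -> U q -> q = p.
Proof.
split=> [[Up /seteqP[D _]]|[Up D]].
  by split=> // q qp Uq; apply: (D q).
split=> //; apply/seteqP; split=> [q [qp Uq]|_ ->]; first exact: D.
by split=> //; exact: path_le_refl.
Qed.

Section weight.
Variables (R : realType) (A : choiceType) (X : pointedType) (P : fpts R A X).
Implicit Types (p q : path A X) (x y z : X) (a b : option A).
Implicit Types (V : set (path A X)).

Lemma exec_path1 x : exec P x (path1 A x).
Proof. by split=> // s a /dom_path1; case: s. Qed.

Lemma exec_pcons z x a p : exec P z (pcons x a p) <->
  [/\ z = x, 0 < P x a (p [::]) & exec P (p [::]) p].
Proof.
split=> [[<- E]|[-> Pp [_ E]]].
  have E0 : 0 < P x a (p [::]).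
    have := E [::] a; rewrite -[rcons _ a]/[:: a] pcons_cons ?prefix0s//; apply.
    by rewrite /dom/= eqxx prefix0s.
split=> //; split=> // s b ds; have := E (a :: s) b.
  rewrite rcons_cons !pcons_cons//; last exact: dom_rcons ds.
  by apply; rewrite /dom/= eqxx.
split=> // -[|c s] b ds.
  have /andP[/eqP ba _] : (b == a) && prefix [::] (trace p) by [].
  by rewrite ba -[rcons _ a]/[:: a] pcons_cons ?prefix0s.
have /andP[/eqP ca dsb] : (c == a) && prefix (rcons s b) (trace p) by [].
rewrite ca rcons_cons !pcons_cons//; last exact: dom_rcons dsb.
exact: E.
Qed.

Lemma path_weight_path1 x : path_weight P (path1 A x) = 1.
Proof.
rewrite /path_weight big_ord0 asboolT//; exists x; exact: exec_path1.
Qed.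

Lemma path_weight_pcons x a p :
  path_weight P (pcons x a p) = P x a (p [::]) * path_weight P p.
Proof.
rewrite /path_weight; case: asboolP => [[z /exec_pcons[_ Pp Ep]]|nE].
  rewrite asboolT; last by exists (p [::]).
  rewrite /= big_ord_recl; congr *%R.
    by rewrite take0 take0 eqxx prefix0s.
  by apply: eq_bigr => i _; rewrite /= eqxx !prefix_take.
case: asboolP => [[z Ep]|]; last by rewrite mulr0.
have [Pp|] := boolP (0 < P x a (p [::])).
  exfalso; apply: nE; exists x; apply/exec_pcons; split=> //.
  by case: Ep => pz ?; split.
by rewrite lt_neqAle fpts_ge0 andbT negbK => /eqP <-; rewrite mul0r.
Qed.

Lemma path_weight_ge0 p : 0 <= path_weight P p.
Proof.
elim/path_cons_ind: p => [x|x a p IH]; first by rewrite path_weight_path1.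
by rewrite path_weight_pcons mulr_ge0// fpts_ge0.
Qed.

(** For open [V] this is the path measure of the paths from [x] in [V]. The form through minimal
    paths allows computing it by summation over the first transition. *)
Definition hit_weight V x : \bar R :=
  set_weight P (minimal_paths (V `&` up (path1 A x))).

Lemma hit_weight1 V x : V (path1 A x) -> hit_weight V x = 1%E.
Proof.
move=> Vx; rewrite /hit_weight; suff -> : minimal_paths (V `&` up (path1 A x)) =
    [set path1 A x].
  by rewrite /set_weight esum_set1 path_weight_path1 ?lee_fin.
apply/seteqP; split=> [p /minimal_pathsE[[Vp xp] m]|_ ->].
  by apply/esym/m => //; split=> //; exact: path_le_refl.
apply/minimal_pathsE; split; first by split=> //; exact: path_le_refl.
by move=> q qx [_ xq]; exact: path_le_anti.
Qed.

(** As the one-state path is not in [V], every path from [x] in [V] has a first transition [t], and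
    minimality is inherited by the remainder. *)
Lemma minimal_paths_pcons V x : ~ V (path1 A x) ->
  minimal_paths (V `&` up (path1 A x)) =
  \bigcup_t (pcons x t.1 @`
    minimal_paths ([set q | V (pcons x t.1 q)] `&` up (path1 A t.2))).
Proof.
move=> nVx; apply/seteqP; split=> [p|_ [[a y] _ [q + <-]]].
  elim/path_cons_ind: p => [y|y a p _]
      /minimal_pathsE[[Vp /path_le_path1/= px] m].
    by rewrite px in Vp.
  subst y; exists (a, p [::]) => //; exists p => //.
  apply/minimal_pathsE; split; first by split=> //; exact/path_le_path1.
  move=> q qp [/= Vq _]; have [] // := @pcons_inj _ _ x a q x a p.
  by apply: m; [exact/path_le_pcons|split=> //; exact/path_le_path1].
move=> /minimal_pathsE[[/= Vq /path_le_path1 qy] m].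
apply/minimal_pathsE; split; first by split=> //; exact/path_le_path1.
move=> r; elim/path_cons_ind: r => [z _ [Vz /path_le_path1/= zx]|z b r _].
  by rewrite zx in Vz.
move=> /path_le_pcons[-> -> rq] [Vr _]; congr pcons; apply: m => //.
split=> //; apply/path_le_path1; case: rq => _ <- //; exact: dom_nil.
Qed.

Lemma hit_weight_ge0 V x : (0 <= hit_weight V x)%E.
Proof. by apply: esum_ge0 => p _; rewrite lee_fin path_weight_ge0. Qed.

Lemma hit_weight_step V x : ~ V (path1 A x) -> hit_weight V x =
  (\esum_(t in [set: option A * X])
    ((P x t.1 t.2)%:E * hit_weight [set q | V (pcons x t.1 q)] t.2))%E.
Proof.
move=> nVx; rewrite /hit_weight minimal_paths_pcons// /set_weight.
pose M t := minimal_paths ([set q | V (pcons x t.1 q)] `&` up (path1 A t.2)).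
have Mnil t q : M t q -> q [::] = t.2.
  by move=> /minimal_pathsE[[_ /path_le_path1]].
transitivity (\esum_(t in [set: option A * X]) \esum_(q in M t)
    (path_weight P (pcons x t.1 q))%:E)%E; last first.
  apply: eq_esum => -[a y] _.
  rewrite -esumZl ?fpts_ge0//; last first.
    by move=> p; rewrite lee_fin path_weight_ge0.
  by apply: eq_esum => p /Mnil /= <-; rewrite path_weight_pcons EFinM.
rewrite esum_esum; last by move=> t q _ _; rewrite lee_fin path_weight_ge0.
(* Prepending is injective on the pairs [(t, q)] with [q] in [M t], because [q] starts in [t.2]. *)
apply: (@reindex_esum _ _ _ _ _ (fun k => pcons x k.1.1 k.2)); split.
- by move=> [t q] [_ Mq]; exists t => //; exists q.
- move=> [[a y] p] [[b z] q] /set_mem[_ /= /Mnil /= <-].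
  by move=> /set_mem[_ /= /Mnil /= <-] /pcons_inj[_ -> ->].
- by move=> _ [t _ [q Mq <-]]; exists (t, q).
Qed.

Definition succ x : {fset option A * X} :=
  fset_set [set t : option A * X | 0 < P x t.1 t.2].

(** The one-step mean of [f]; finite branching makes it a finite sum of reals, on which linear
    algebra can be done. *)
Definition step x (f : option A -> X -> R) : R :=
  \sum_(t <- succ x) P x t.1 t.2 * f t.1 t.2.

Lemma esum_step x (f : option A -> X -> R) : (forall a y, 0 <= f a y) ->
  (\esum_(t in [set: option A * X]) ((P x t.1 t.2)%:E * (f t.1 t.2)%:E) =
   (step x f)%:E)%E.
Proof.
move=> f0; transitivity (\esum_(t in
    [set t : option A * X | (0 < P x t.1 t.2)%R])
    ((P x t.1 t.2)%:E * (f t.1 t.2)%:E))%E.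
  rewrite [RHS]esum_mkcond; apply: eq_esum => t _; case: ifPn => //.
  rewrite notin_setE /= => /negP.
  by rewrite lt_neqAle fpts_ge0 andbT negbK => /eqP <-; rewrite mul0e.
have fin := fpts_finite P x.
rewrite esum_fset//; last by move=> t _; rewrite mule_ge0// lee_fin// fpts_ge0.
by rewrite fsbig_finite// sumEFin.
Qed.

Lemma step_ge0 x f : (forall a y, 0 <= f a y) -> 0 <= step x f.
Proof. by move=> f0; apply: sumr_ge0 => t _; rewrite mulr_ge0// fpts_ge0. Qed.

Lemma le_step x f g : (forall a y, f a y <= g a y) -> step x f <= step x g.
Proof. by move=> fg; apply: ler_sum => t _; rewrite ler_wpM2l// fpts_ge0. Qed.

Lemma eq_step x f g : (forall a y, f a y = g a y) -> step x f = step x g.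
Proof. by move=> fg; apply: eq_bigr => t _; rewrite fg. Qed.

Lemma stepD x f g : step x (fun a y => f a y + g a y) = step x f + step x g.
Proof. by rewrite -big_split; apply: eq_bigr => t _; rewrite mulrDr. Qed.

Lemma stepZ x c f : step x (fun a y => c * f a y) = c * step x f.
Proof. by rewrite big_distrr; apply: eq_bigr => t _; rewrite mulrCA. Qed.

Lemma step_sum x (I : Type) (s : seq I) (c : I -> R) f :
  step x (fun a y => \sum_(i <- s) c i * f i a y) =
  \sum_(i <- s) c i * step x (f i).
Proof.
elim: s => [|i s IH].
  by rewrite big_nil; apply: big1 => t _; rewrite big_nil mulr0.
rewrite big_cons -IH -stepZ -stepD.
by apply: eq_step => a y; rewrite big_cons.
Qed.

Lemma step1_le1 x : step x (fun _ _ => 1) <= 1.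
Proof.
rewrite -lee_fin -esum_step//.
under eq_esum do rewrite mule1.
by case: (fpts_sum P x) => ->.
Qed.

Lemma le_norm_step x f : `|step x f| <= step x (fun a y => `|f a y|).
Proof.
apply: le_trans (ler_norm_sum _ _ _) _; apply: ler_sum => t _.
by rewrite normrM (ger0_norm (fpts_ge0 _ _ _ _)).
Qed.

(** Paths that are not executions from [x] contribute nothing to either side; for an execution,
    being first to reach [Z] is minimality in [hits a Z]. *)
Lemma reach_probE x a (Z : set X) :
  reach_prob P x (taus_hat a) Z = hit_weight (hits a Z) x.
Proof.
rewrite /reach_prob /hit_weight /set_weight [LHS]esum_mkcond [RHS]esum_mkcond.
apply: eq_esum => p _; have [Ep|nE] := pselect (exec P x p); last first.
  rewrite memNset; last by case.
  case: ifPn => //; move=> /set_mem /minimal_pathsE[[_ /path_le_path1 px] _].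
  rewrite /path_weight asboolF// => -[z Ez]; apply: nE.
  by case: Ez => pz ?; split.
rewrite (_ : (p \in _) = (p \in minimal_paths (hits a Z `&` up (path1 A x))))//.
have px : up (path1 A x) p by apply/path_le_path1; case: Ep.
have HL q : taus_hat a (trace q) -> Z (last_state q) -> hits a Z q.
  by exists (trace q); split=> //; exact: prefix_refl.
(* A hit at the prefix [s] is turned into a hit at the end of a path by cutting [q] off at [s]. *)
have restr (q : path A X) s : dom q s -> exists q', [/\ path_le q' q,
    trace q' = s & last_state q' = q s].
  move=> /prefixP[u tq].
  elim/path_cons_ind: q s u tq => [y [|//] [|//] _|y b q IH s u].
    by exists (path1 A y); split=> //; exact: path_le_refl.
  case: s => [_|c s].
    by exists (path1 A y); split=> //; exact/path_le_path1.
  move=> [<- tq]; have [q' [qq' tq' l]] := IH _ _ tq.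
  exists (pcons y b q'); split=> //; [exact/path_le_pcons|by rewrite -tq'|].
  by rewrite last_state_pcons l pcons_cons// tq prefix_prefix.
apply/idP/idP => [/set_mem[_ Lp Zp m]|
    /set_mem/minimal_pathsE[[[s [sp Ls Zs]] _] m]]; apply/mem_set.
  apply/minimal_pathsE; split; first by split=> //; exact: HL.
  move=> q qp [[s [sq Ls Zs]] _].
  have [q' [qq' tq' lq']] := restr _ _ sq.
  have [q'p|q'N] := pselect (q' = p).
    by apply: path_le_anti => //; rewrite -q'p.
  by have := m _ (path_le_trans qq' qp) q'N; rewrite tq' lq' => /(_ Ls).
have [q [qp tq lq]] := restr _ _ sp.
have xq : up (path1 A x) q.
  apply/path_le_path1; case: qp => _ <-; last exact: dom_nil.
  by case: Ep.
have qE : q = p by apply: m => //; split=> //; apply: HL; rewrite ?tq ?lq.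
split=> //; rewrite -?qE ?tq ?lq//.
move=> r rq rqN Lr Zr; apply: rqN; rewrite qE.
apply: m; first by rewrite -qE.
split; first exact: HL.
apply/path_le_path1; case: rq => _ <-; last exact: dom_nil.
exact/path_le_path1.
Qed.

End weight.

(** A square matrix with trivial left kernel is invertible, so its right kernel is trivial as well.
    Rows and columns are both indexed by [s]. *)
Lemma left_kernel_trivial (R : fieldType) (T : eqType) (s : seq T)
    (h : T -> T -> R) : uniq s ->
  (forall c, (forall i, i \in s -> \sum_(j <- s) c j * h j i = 0) ->
    forall j, j \in s -> c j = 0) ->
  forall e, (forall j, j \in s -> \sum_(i <- s) e i * h j i = 0) ->
    forall i, i \in s -> e i = 0.
Proof.
case: s => [//|x0 s0]; set s := x0 :: s0 => us inj e eh i si.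
pose n := size s.
pose H : 'M[R]_n := \matrix_(j, i) h (nth x0 s j) (nth x0 s i).
(* Vectors indexed by positions become functions on [T], with default value 0 off [s]; uniqueness of
   the entries makes this consistent. *)
have idx (c : 'I_n -> R) :
    exists c' : T -> R, forall k : 'I_n, c' (nth x0 s k) = c k.
  exists (fun x => if insub (index x s) is Some k then c k else 0) => k.
  by rewrite index_uniq// valK.
have Hfree : row_free H.
  rewrite -kermx_eq0; apply/eqP/row_matrixP => k; rewrite row0.
  have /sub_kermxP := row_sub k (kermx H).
  move: (row k _) => u uH; have [c cE] := idx (u ord0).
  apply/rowP => j; rewrite [RHS]mxE -cE; apply: inj; last exact: mem_nth.
  move=> y /(nthP x0)[i0 i0n <-].
  move/rowP: uH => /(_ (Ordinal i0n)); rewrite !mxE => uH.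
  rewrite (big_nth x0) big_mkord -[RHS]uH; apply: eq_bigr => l _.
  by rewrite cE mxE.
have Hu : H^T \in unitmx by rewrite unitmx_tr -row_free_unit.
pose v : 'rV[R]_n := \row_k e (nth x0 s k).
have v0 : v = 0.
  apply: (can_inj (mulmxK Hu)); rewrite mul0mx; apply/rowP => j; rewrite !mxE.
  rewrite -[RHS](eh (nth x0 s j)) ?mem_nth// (big_nth x0) big_mkord.
  by apply: eq_bigr => l _; rewrite !mxE.
move: si => /(nthP x0)[i0 i0n <-].
by move/rowP: v0 => /(_ (Ordinal i0n)); rewrite !mxE.
Qed.

(** * Probabilities of open events under the path measure *)

Section path_measure.
Variables (R : realType) (A : choiceType) (X : pointedType) (P : fpts R A X).
Variables (mu : {measure set (bpath A X) -> \bar R}).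
Hypothesis muP : is_path_measure P mu.
Implicit Types (p q : path A X) (x y z : X) (a b : option A).
Implicit Types (V : set (path A X)).

Lemma open_setI_up V x : path_open V -> open (V `&` up (path1 A x)).
Proof.
move=> oV; rewrite path_openE; apply: path_openI => //.
by rewrite -path_openE; exact: open_up.
Qed.

Lemma mu_up_path1 V x : path_open V ->
  mu (V `&` up (path1 A x)) = hit_weight P V x.
Proof.
by move=> oV; rewrite muP//; exact: open_setI_up.
Qed.

Lemma hit_weight_le1 V x : path_open V -> (hit_weight P V x <= 1)%E.
Proof.
move=> oV; rewrite -(hit_weight1 P (V := setT) (x := x))// -!mu_up_path1//.
apply: (@le_measure _ _ (bpath A X) mu); last exact: setSI.
  by apply: mem_set; apply: sub_sigma_algebra; exact: open_setI_up.
by apply: mem_set; apply: sub_sigma_algebra; exact: open_setI_up.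
Qed.

(** For open [V], [fine] loses nothing, since the weight is at most 1 by monotonicity of [mu]. *)
Definition prob V x : R := fine (hit_weight P V x).

Lemma probE V x : path_open V -> (prob V x)%:E = hit_weight P V x.
Proof.
move=> oV; rewrite fineK// fin_numElt.
rewrite (lt_le_trans _ (hit_weight_ge0 _ _ _))//=.
by rewrite (le_lt_trans (hit_weight_le1 _ _))// ltry.
Qed.

Lemma prob_ge0 V x : 0 <= prob V x.
Proof. by apply: fine_ge0; exact: hit_weight_ge0. Qed.

Lemma prob_le1 V x : path_open V -> prob V x <= 1.
Proof. by move=> oV; rewrite -lee_fin probE// hit_weight_le1. Qed.

Lemma prob1 V x : V (path1 A x) -> prob V x = 1.
Proof. by move=> Vx; rewrite /prob hit_weight1. Qed.

Lemma eq_prob V W x : (forall p, p [::] = x -> V p <-> W p) ->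
  prob V x = prob W x.
Proof.
move=> VW; rewrite /prob /hit_weight.
suff -> : V `&` up (path1 A x) = W `&` up (path1 A x) by [].
by apply/seteqP; split=> p [Vp /path_le_path1 px];
  (split; [exact/VW|exact/path_le_path1]).
Qed.

Lemma prob0 x : prob set0 x = 0.
Proof.
rewrite /prob /hit_weight set0I (_ : minimal_paths set0 = set0).
  by rewrite /set_weight esum_set0.
by apply/seteqP; split=> // p [].
Qed.

Lemma path_open_pcons V x a : path_open V ->
  path_open [set q | V (pcons x a q)].
Proof. by move=> oV p q /= Vp pq; apply: oV Vp _; exact/path_le_pcons. Qed.

Lemma prob_step V x : path_open V -> ~ V (path1 A x) ->
  prob V x = step P x (fun a y => prob [set q | V (pcons x a q)] y).
Proof.
move=> oV nVx; apply: EFin_inj; rewrite probE// hit_weight_step//.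
rewrite -esum_step//; last by move=> a y; exact: prob_ge0.
by apply: eq_esum => t _; rewrite probE//; exact: path_open_pcons.
Qed.

(* Paths are finite, so the events "at least n steps" decrease to the empty
   set: the existence of the path measure forces almost sure termination. *)
Lemma subharmonic_eq0 (M : R) (d : X -> R) :
  (forall x, 0 <= d x) -> (forall x, d x <= M) ->
  (forall x, d x <= step P x (fun _ y => d y)) -> forall x, d x = 0.
Proof.
move=> d0 dM dstep x.
pose N n : set (path A X) := [set p | (n <= size (trace p))%N].
have oN n : path_open (N n).
  by move=> p q np [/(_ _ (dom_trace p))/size_prefix/(leq_trans np)].
(* Iterating the hypothesis [n] times leaves only paths with at least [n] steps, and [d] is at most
   [M] at their ends. *)
have dN n y : d y <= M * prob (N n) y.
  elim: n y => [|n IH] y; first by rewrite prob1// mulr1.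
  rewrite prob_step// -stepZ; apply: (le_trans (dstep y)).
  by apply: le_step => a z; exact: IH.
have cvgN : prob (N n) x @[n --> \oo] --> (0 : R).
  pose F n := N n `&` up (path1 A x).
  have mF n : measurable (F n : set (bpath A X)).
    by apply: sub_sigma_algebra; exact: open_setI_up.
  have F0 : \bigcap_n F n = set0.
    apply/seteqP; split=> // p /(_ (size (trace p)).+1 I)[].
    by rewrite /N /= ltnn.
  have : mu \o (F : (set (bpath A X))^nat) @ \oo --> mu (\bigcap_n F n).
    apply: nonincreasing_cvg_mu => //.
    - rewrite mu_up_path1//; apply: le_lt_trans (hit_weight_le1 _ _) _ => //.
      exact: ltry.
    - by rewrite F0; exact: measurable0.
    - move=> m n mn; apply/subsetPset => p [Np xp]; split=> //.
      exact: leq_trans mn _.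
  rewrite F0 measure0 => /fine_cvg; rewrite (_ : fine \o _ = prob^~ x \o N)//.
  by apply/funext => n /=; rewrite /F mu_up_path1.
apply/eqP; rewrite eq_le d0 andbT.
have : M * prob (N n) x @[n --> \oo] --> M * 0.
  by apply: cvgM => //; exact: cvg_cst.
by rewrite mulr0 => /cvgr_to_ge; apply; apply: nearW => n; exact: dN.
Qed.

Lemma open_hits a (D : set X) : path_open (hits a D).
Proof. by move=> p q; exact: hits_le. Qed.

(** Outside [D] a first step is needed, and a visible one rules out any later hit. *)
Lemma prob_hits_tau_step x (D : set X) : ~ D x ->
  prob (hits None D) x =
  step P x (fun b y => if b == None then prob (hits None D) y else 0).
Proof.
move=> nDx; rewrite prob_step; [|exact: open_hits|by move=> /hits_path1[]].
apply: eq_step => b y; have [->|/eqP bN] := eqVneq b None.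
  apply: eq_prob => p _; rewrite /= hits_pcons.
  by split=> [[[]|[]|[]]|] // ?; apply: Or32.
rewrite -[RHS](prob0 y); apply: eq_prob => p _; rewrite /= hits_pcons.
by split=> // -[[]|[]|[]].
Qed.

(** After a silent step the event starts afresh; a visible first step decides it at once. *)
Lemma prob_hits_step x a (D : set X) : a <> None ->
  prob (hits a D) x =
  step P x (fun b y => if b == None then prob (hits a D) y
                       else ((b == a) && `[< D y >])%:R).
Proof.
move=> aN; rewrite prob_step; [|exact: open_hits|by move=> /hits_path1[]].
apply: eq_step => b y; have [->|/eqP bN] := eqVneq b None.
  apply: eq_prob => p _; rewrite /= hits_pcons.
  split=> [[[]|[]|[_]]|] //; last by move=> ?; apply: Or32.
  by move/esym.
have [->/=|/eqP ba] := eqVneq b a; last first.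
  rewrite -[RHS](prob0 y); apply: eq_prob => p _; rewrite /= hits_pcons.
  by split=> // -[[]|[]|[]].
case: asboolP => Dy.
  rewrite -[RHS](@prob1 setT y)//; apply: eq_prob => p py; split=> // _.
  by rewrite /= hits_pcons; apply: Or33; split=> //; rewrite py.
rewrite -[RHS](prob0 y); apply: eq_prob => p py; rewrite /= hits_pcons.
by split=> // -[[]|[]|[]] //; rewrite py.
Qed.

(** * Hitting probabilities of classes and the proportions in which a class is left *)

Section classes.
Variable k : X -> X.
Hypothesis kk : forall x, k (k x) = k x.

(** The class of [y] if [k y = y], and empty otherwise. *)
Definition cls y : set X := [set z | k z = y].

Hypothesis kP : forall x x' a y, k x = k x' ->
  prob (hits a (cls y)) x = prob (hits a (cls y)) x'.

Local Notation h y := (prob (hits None (cls y))).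

Lemma hit_self x : h (k x) x = 1.
Proof. by apply: prob1; apply/hits_path1. Qed.

(** The combination [u] vanishes on the listed classes and is harmonic elsewhere, hence zero. A
    nonzero coefficient at [D0] would then make return to [D0] certain, contradicting
    termination. *)
Lemma hit_matrix_inj (s : seq X) (c : X -> R) : uniq s ->
  (forall E, E \in s -> k E = E) ->
  (forall E, E \in s -> \sum_(D <- s) c D * h D E = 0) ->
  forall D, D \in s -> c D = 0.
Proof.
move=> us sk ch D0 sD0; pose u x := \sum_(D <- s) c D * h D x.
have uk x : u x = u (k x).
  by apply: eq_bigr => D _; congr (_ * _); apply: kP; rewrite kk.
have h0 D x := prob_ge0 (hits None (cls D)) x.
have h1 D x : h D x <= 1 by apply: prob_le1; exact: open_hits.
have stepu x : step P x (fun b y => if b == None then u y else 0) =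
    \sum_(D <- s) c D * step P x (fun b y => if b == None then h D y else 0).
  rewrite -step_sum; apply: eq_step => b y; case: eqP => // _.
  by rewrite big1// => D _; rewrite mulr0.
have ustep x : k x \notin s ->
    u x = step P x (fun b y => if b == None then u y else 0).
  move=> nsx; rewrite stepu; apply: eq_big_seq => D sD; congr (_ * _).
  by apply: prob_hits_tau_step => /= kxD; rewrite kxD sD in nsx.
have u0 x : u x = 0.
  apply/eqP; rewrite -normr_eq0; apply/eqP.
  apply: (@subharmonic_eq0 (\sum_(D <- s) `|c D|) (fun x => `|u x|)) => //.
    move=> y; apply: le_trans (ler_norm_sum _ _ _) _; apply: ler_sum => D _.
    by rewrite normrM ler_piMr// ger0_norm.
  move=> y; have [sy|nsy] := boolP (k y \in s).
    by rewrite uk /u ch// normr0; apply: step_ge0.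
  rewrite {1}ustep//; apply: le_trans (le_norm_step _ _ _) _.
  by apply: le_step => b z; case: eqP; rewrite ?normr0.
apply/eqP/negPn/negP => cN0.
(* At [x] in [D0], both [u] and its silent one-step mean vanish, and their terms for [D != D0]
   agree. Comparing the remaining terms and cancelling [c D0] gives the claim. *)
have ret x : k x = D0 ->
    step P x (fun b y => if b == None then h D0 y else 0) = 1.
  move=> xD0.
  have : step P x (fun b y => if b == None then u y else 0) = 0.
    by apply: big1 => t _; rewrite u0 if_same mulr0.
  rewrite stepu => su; have ux := u0 x; rewrite /u in ux.
  rewrite (bigD1_seq D0)//= in su; rewrite (bigD1_seq D0)//= in ux.
  have hx : h D0 x = 1 by rewrite -xD0 hit_self.
  have e : \sum_(D <- s | D != D0) c D * h D x = \sum_(D <- s | D != D0)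
      c D * step P x (fun b y => if b == None then h D y else 0).
    apply: eq_bigr => D DN; congr (_ * _); apply: prob_hits_tau_step.
    by move=> /= xD; rewrite -xD xD0 eqxx in DN.
  by rewrite e -[RHS]su hx in ux; move/addIr: ux => /(mulfI cN0) ->.
(* By [ret], [h D0] is dominated by its one-step mean inside [D0] too, so it vanishes, although it
   is 1 on [D0]. *)
have : h D0 D0 = 0.
  apply: (@subharmonic_eq0 1 (h D0)) => // x.
  apply: (@le_trans _ _
    (step P x (fun b y => if b == None then h D0 y else 0))).
    have [xD0|xD0] := eqVneq (k x) D0; first by rewrite ret// h1.
    by rewrite {1}prob_hits_tau_step//; apply/eqP.
  by apply: le_step => b z; case: eqP.
by rewrite -{1}(sk _ sD0) hit_self => /eqP; rewrite oner_eq0.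
Qed.

(** This is [P(x,a,C)] for the class [C] represented by [y]. *)
Definition jump x a y : R := step P x (fun b z => ((b == a) && (k z == y))%:R).

Lemma step_tau_classes x (s : seq X) (f : X -> R) : uniq s -> k x \notin s ->
  (forall t, t \in succ P x -> k t.2 \in k x :: s) ->
  (forall z, f z = f (k z)) ->
  step P x (fun b z => if b == None then f z else 0) =
  jump x None (k x) * f (k x) + \sum_(E <- s) jump x None E * f E.
Proof.
move=> us xs succs fk.
transitivity (\sum_(E <- k x :: s) f E * jump x None E); last first.
  rewrite big_cons mulrC; congr (_ + _).
  by apply: eq_bigr => E _; rewrite mulrC.
rewrite -step_sum; apply: eq_big_seq => t st; congr (_ * _).
have ust : uniq (k x :: s) by rewrite /= xs.
rewrite (bigD1_seq (k t.2))/= ?succs// eqxx andbT big1 ?addr0; last first.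
  by move=> E; rewrite eq_sym => /negbTE ->; rewrite andbF mulr0.
by case: eqP => _; rewrite ?mulr1 ?mulr0// fk.
Qed.

(** Equality of the exit ratios [jump x a y / (1 - jump x None (k x))], cross-multiplied because a
    denominator may be 0. The excluded case is the silent step inside the class. *)
Lemma jump_proportional x x' a y : k x = k x' -> ~ (a = None /\ y = k x) ->
  jump x a y * (1 - jump x' None (k x)) = jump x' a y * (1 - jump x None (k x)).
Proof.
move=> xx' ay.
(* All classes other than their own that [x] or [x'] can enter in one step. *)
pose s := [seq z <- undup [seq k t.2 |
  t <- enum_fset (succ P x) ++ enum_fset (succ P x')] | z != k x].
have us : uniq s by rewrite filter_uniq// undup_uniq.
have xs : k x \notin s by rewrite mem_filter eqxx.
have succs t : (t \in succ P x) || (t \in succ P x') -> k t.2 \in k x :: s.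
  move=> st; rewrite inE mem_filter; case: eqVneq => //= _.
  by rewrite mem_undup; apply: map_f; rewrite mem_cat.
have sk E : E \in s -> k E = E.
  by rewrite mem_filter mem_undup => /andP[_ /mapP[t _ ->]].
have stE f : (forall z, f z = f (k z)) ->
    step P x (fun b z => if b == None then f z else 0) =
    jump x None (k x) * f (k x) + \sum_(E <- s) jump x None E * f E.
  by apply: step_tau_classes => // t tx; apply: succs; rewrite tx.
have stE' f : (forall z, f z = f (k z)) ->
    step P x' (fun b z => if b == None then f z else 0) =
    jump x' None (k x) * f (k x) + \sum_(E <- s) jump x' None E * f E.
  move=> fk; rewrite xx'; apply: step_tau_classes => //; first by rewrite -xx'.
  by move=> t tx; rewrite -xx'; apply: succs; rewrite tx orbT.
pose e E := jump x None E * (1 - jump x' None (k x)) -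
            jump x' None E * (1 - jump x None (k x)).
have sum_e f : \sum_(E <- s) e E * f E =
    (\sum_(E <- s) jump x None E * f E) * (1 - jump x' None (k x)) -
    (\sum_(E <- s) jump x' None E * f E) * (1 - jump x None (k x)).
  rewrite !big_distrl -sumrB; apply: eq_bigr => E _; rewrite /e /=; ring.
(* For each [D] in [s], the one-step equations of [h D] at [x] and [x'], cross-multiplied and
   subtracted, say that [e] is orthogonal to the row of [D]. *)
have e0 E : E \in s -> e E = 0.
  move: E; apply: (@left_kernel_trivial _ _ s (fun D E => h D E)) => //.
    by move=> c; exact: hit_matrix_inj.
  move=> D sD; have Dx : k x <> D by move=> xD; rewrite -xD (negPf xs) in sD.
  have hk z : h D z = h D (k z) by apply: kP; rewrite kk.
  have := @prob_hits_tau_step x (cls D) Dx; rewrite (stE _ hk).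
  have Dx' : k x' <> D by rewrite -xx'.
  have := @prob_hits_tau_step x' (cls D) Dx'; rewrite (stE' _ hk).
  rewrite (hk x') (hk x) -xx' sum_e => E1 E2.
  set S1 := (\sum_(E <- s) jump x None E * _) in E2 *.
  set S2 := (\sum_(E <- s) jump x' None E * _) in E1 *.
  have -> : S1 = h D (k x) * (1 - jump x None (k x)).
    by rewrite mulrBr mulr1 {1}E2; ring.
  have -> : S2 = h D (k x) * (1 - jump x' None (k x)).
    by rewrite mulrBr mulr1 {1}E1; ring.
  ring.
have [aN|/eqP aN] := eqVneq a None.
  have yx : y <> k x by move=> ?; apply: ay.
  rewrite aN; have [sy|nsy] := boolP (y \in s).
    by apply/eqP; rewrite -subr_eq0; apply/eqP; exact: e0.
  have j0 z : (forall t, t \in succ P z ->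
      (t \in succ P x) || (t \in succ P x')) ->
      jump z None y = 0.
    move=> zs; apply: big1_seq => t /= tz.
    case: (eqVneq (k t.2) y) => [ty|]; last by rewrite andbF mulr0.
    have := succs t (zs _ tz); rewrite ty inE (negbTE nsy) orbF => /eqP.
    by [].
  by rewrite !j0 ?mul0r// => t ->; rewrite ?orbT.
(* For visible [a] the one-step equation of [g] has the extra term [jump z a y]. The silent
   contributions cancel by [e0], which leaves the proportionality of that term. *)
pose g := prob (hits a (cls y)).
have gk z : g z = g (k z) by apply: kP; rewrite kk.
have gstep z : g z =
    step P z (fun b w => if b == None then g w else 0) + jump z a y.
  rewrite {1}/g prob_hits_step// -stepD; apply: eq_step => b w.
  case: eqP => [->|_]; last first.
    rewrite add0r; congr (_ && _)%:R; exact/asboolP/eqP.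
  by case: eqP => [/esym//|]; rewrite addr0.
have := sum_e g; rewrite big1_seq; last by move=> E /= sE; rewrite e0// mul0r.
have := gstep x; rewrite stE//; have := gstep x'; rewrite stE'//.
rewrite (gk x') (gk x) -xx' => E1 E2 /esym/eqP; rewrite subr_eq0 => /eqP.
set S1 := (\sum_(E <- s) jump x None E * _) in E2 *.
set S2 := (\sum_(E <- s) jump x' None E * _) in E1 *.
set j := jump x a y in E2 *; set j' := jump x' a y in E1 *.
have -> : S1 = g (k x) * (1 - jump x None (k x)) - j.
  by rewrite mulrBr mulr1 {1}E2; ring.
have -> : S2 = g (k x) * (1 - jump x' None (k x)) - j'.
  by rewrite mulrBr mulr1 {1}E1; ring.
move=> E3; apply/eqP; rewrite -subr_eq0; apply/eqP.
move/eqP: E3; rewrite -subr_eq0 => /eqP E3; rewrite -[RHS]oppr0 -[in RHS]E3.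
ring.
Qed.

End classes.

End path_measure.

(** * Stutter-reduced images of paths under the class map *)

Section stutter_classes.
Variables (R : realType) (A : choiceType) (X : pointedType) (P : fpts R A X).
Variables (mu : {measure set (bpath A X) -> \bar R}).
Hypothesis muP : is_path_measure P mu.
Variable k : X -> X.
Hypothesis kk : forall x, k (k x) = k x.
Hypothesis kP : forall x x' a y, k x = k x' ->
  prob P (hits a (cls k y)) x = prob P (hits a (cls k y)) x'.

(** For stutter-free [q], the inverse image in the paths of the up-set of the stutter class of
    [q]. *)
Definition above (q : path A X) : set (path A X) :=
  [set p | path_le q (st (path_map k p))].

Lemma open_above q : path_open (above q).
Proof.
by move=> p p' qp pp'; apply: path_le_trans qp _; exact/st_le/path_map_le.
Qed.

Lemma above_nil q p : above q p -> k (p [::]) = q [::].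
Proof.
by move=> [_ /(_ _ (dom_nil q))]; rewrite st_nil.
Qed.

Lemma jump_ratio a y y1 : ~ (a = None /\ y1 = y) ->
  exists c, forall x, k x = y -> jump P k x a y1 = c * (1 - jump P k x None y).
Proof.
move=> ay; have [[x0 [x0y j0]]|none] :=
    pselect (exists x0, k x0 = y /\ jump P k x0 None y != 1).
  exists (jump P k x0 a y1 / (1 - jump P k x0 None y)) => x xy.
  have j0' : 1 - jump P k x0 None y != 0 by rewrite subr_eq0 eq_sym.
  have xx0 : k x = k x0 by rewrite xy.
  have := @jump_proportional _ _ _ _ _ muP _ kk kP x x0 a y1 xx0.
  rewrite xy => /(_ ay) e.
  by rewrite -[LHS](mulfK j0') e mulrAC.
(* Otherwise every state of the class stays in it silently with probability 1, which leaves no mass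
   for the exit. *)
exists 0 => x xy; rewrite mul0r; apply/eqP; rewrite eq_le andbC step_ge0//=.
have j1 : jump P k x None y = 1.
  by apply/eqP/negPn/negP => jN; apply: none; exists x.
rewrite -(lerD2l (jump P k x None y)) addr0 {2}j1.
apply: le_trans (step1_le1 P x); rewrite -stepD; apply: le_step => b z.
have [/andP[/eqP-> /eqP zy]|_] := boolP ((b == None) && (k z == y)).
  case: (boolP (_ && _)) => [/andP[/eqP aN /eqP zy1]|_]; last by rewrite addr0.
  by exfalso; apply: ay; rewrite -aN -zy1.
by rewrite add0r; case: (_ && _).
Qed.

(* Subtracting the value predicted by the exit ratios of the first class leaves
   a bounded function which is harmonic up to the exit from that class. *)
Lemma prob_above_cls q : exists c, forall x,
  prob P (above (st q)) x = if k x == q [::] then c else 0.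
Proof.
elim/path_cons_ind: q => [y|y a q [c IH]].
  exists 1 => x; rewrite st_path1 /=; case: eqVneq => [xy|/eqP xy].
    by apply: prob1; apply/path_le_path1; rewrite st_nil.
  rewrite -[RHS](prob0 P x); apply: eq_prob => p px.
  by split=> // /above_nil /=; rewrite px.
rewrite st_pcons; case: ifPn => [/andP[_ /eqP qy]|ay].
  by exists c => x; rewrite IH qy.
set y1 := q [::] in IH ay.
have {}ay : ~ (a = None /\ y1 = y).
  by move=> [aN y1y]; move: ay; rewrite aN y1y !eqxx.
pose V := above (pcons y a (st q)).
have oV : path_open V by exact: open_above.
have V0 x : k x <> y -> prob P V x = 0.
  move=> xy; rewrite -[RHS](prob0 P x); apply: eq_prob => p px.
  by split=> // /above_nil /=; rewrite px.
(* A silent step inside the class is erased and [V] starts afresh; an [a]-step into [y1] leaves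
   [st q] to be followed, with probability [c]; any other step fails. *)
have Vstep x : k x = y -> prob P V x =
    step P x (fun b z => if (b == None) && (k z == y) then prob P V z else 0) +
    c * jump P k x a y1.
  move=> xy; rewrite (prob_step muP)//; last first.
    rewrite /V /above /= path_map_path1 st_path1; exact: pcons_le_path1.
  rewrite -stepZ -stepD; apply: eq_step => b z.
  have [/andP[/eqP -> /eqP zy]|bz] := boolP ((b == None) && (k z == y)).
    rewrite (_ : _ && _ = false) ?mulr0 ?addr0; last first.
      by apply/negP => /andP[/eqP aN /eqP zy1]; apply: ay; rewrite aN -zy1.
    apply: eq_prob => p pz; rewrite /V /above /= path_map_pcons st_pcons.
    by rewrite /= pz zy xy eqxx.
  rewrite add0r; have E (p : path A X) : p [::] = z ->
      [set q0 | V (pcons x b q0)] p <-> b = a /\ above (st q) p.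
    move=> pz; rewrite /V /above /= path_map_pcons st_pcons.
    rewrite /= pz xy (negbTE bz) path_le_pcons.
    by split=> [[]|[->]].
  have [ba|/eqP ba] := eqVneq b a; last first.
    rewrite mulr0 -[RHS](prob0 P z); apply: eq_prob => p pz.
    by split=> // /(E _ pz)[].
  transitivity (prob P (above (st q)) z).
    apply: eq_prob => p pz; split=> [/(E _ pz)[]|qp] //.
    by apply/(E _ pz).
  by rewrite IH; case: eqP; rewrite ?mulr1 ?mulr0.
have [c' c'P] := jump_ratio ay.
(* [c'] is the proportion of exits by [a] into [y1], and [c] the probability of continuing along
   [st q] from there. *)
exists (c * c') => x; case: eqVneq => [xy|/eqP xy]; last exact: V0.
pose d x := if k x == y then prob P V x - c * c' else 0.
suff : `|d x| = 0.
  by move/eqP; rewrite normr_eq0 /d xy eqxx subr_eq0 => /eqP.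
apply: (@subharmonic_eq0 _ _ _ _ _ muP (1 + `|c * c'|)
  (fun x => `|d x|)) => // z.
  rewrite /d; case: ifP => _; last by rewrite normr0 addr_ge0.
  apply: le_trans (ler_normB _ _) _; rewrite lerD2r ger0_norm ?prob_ge0//.
  exact: (prob_le1 muP).
rewrite {1}/d; case: eqP => [zy|_]; last by rewrite normr0 step_ge0.
(* By [c'P] the exit term is [c * c' * (1 - jump P k z None y)], so after subtracting [c * c'] only
   the silent steps inside the class remain. *)
have -> : prob P V z - c * c' = step P z (fun b w =>
    if (b == None) && (k w == y) then d w else 0).
  rewrite Vstep// c'P//.
  rewrite (_ : step P z (fun b w => if _ then d w else 0) =
    step P z (fun b w => (if (b == None) && (k w == y) then prob P V w else 0) +
     (- (c * c')) * ((b == None) && (k w == y))%:R)).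
    by rewrite stepD stepZ -/(jump _ _ _ _ _); ring.
  apply: eq_step => b w; rewrite /d; case: (b == None) => /=.
    by case: (k w == y); rewrite ?mulr1 ?mulr0 ?addr0.
  by rewrite mulr0 addr0.
apply: le_trans (le_norm_step _ _ _) _; apply: le_step => b w.
by case: ifP; rewrite ?normr0.
Qed.

End stutter_classes.

(** * Countability of paths and uniqueness of measures on stutter classes *)

Section countability.
Variables (A : choiceType) (X : pointedType).
Hypotheses (cX : countable [set: X]) (cA : countable [set: option A]).

Lemma countable_path : countable [set: path A X].
Proof.
have /countable_injP[g ginj] := cX; have /countable_injP[e einj] := cA.
have {}ginj : injective g by move=> x y; apply: ginj; rewrite in_setT.
have {}einj : injective e by move=> x y; apply: einj; rewrite in_setT.
have [v vE] : exists v : path A X -> seq nat,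
    forall (p : path A X) s, dom p s ->
    nth 0%N (v p) (size s) = g (p s).
  (* The codes of the states along the trace, indexed by prefix length; a trace of length [n] has
     [n.+1] prefixes. *)
  exists (fun p : path A X =>
    [seq g (p (take i (trace p))) | i <- iota 0 (size (trace p)).+1]).
  move=> p s /prefixP[u ps].
  have sp : (size s < (size (trace p)).+1)%N.
    by rewrite ps size_cat ltnS leq_addr.
  rewrite (nth_map 0%N) ?size_iota// nth_iota// add0n.
  by rewrite {1}ps take_size_cat.
apply/countable_injP.
exists (fun p : path A X => choice.pickle (map e (trace p), v p)).
move=> p q _ _ /(pcan_inj choice.pickleK)[/(inj_map einj) pq vpq].
apply: path_ext => // s sp; apply: ginj; rewrite -!vE ?vpq//.
by rewrite /dom /= -pq.
Qed.

Lemma countable_pathsim : countable [set: pathsim A X].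
Proof.
have /countable_injP[g ginj] := countable_path; apply/countable_injP.
exists (g \o repr) => c d _ _ /ginj cd.
by rewrite -[c]reprK -[d]reprK cd// in_setT.
Qed.

Definition upsim (c : pathsim A X) : set (pathsim A X) :=
  [set d | pathsim_le c d].

Lemma path_le_total (p q r : path A X) : path_le p r -> path_le q r ->
  path_le p q \/ path_le q p.
Proof.
move=> [pr rp] [qr rq].
have := prefix_total (pr _ (dom_trace p)) (qr _ (dom_trace q)).
case=> [pq|qp]; [left|right]; split=> s ds.
- exact: prefix_trans ds pq.
- by rewrite -rp// rq//; exact: prefix_trans ds pq.
- exact: prefix_trans ds qp.
- by rewrite -rq// rp//; exact: prefix_trans ds qp.
Qed.

(** Paths below a common path are comparable, so two up-sets are disjoint or nested. *)
Lemma upsimI (c d : pathsim A X) :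
  [\/ upsim c `&` upsim d = set0, upsim c `&` upsim d = upsim c |
      upsim c `&` upsim d = upsim d].
Proof.
have [->|/set0P[e [ce de]]] := eqVneq (upsim c `&` upsim d) set0.
  exact: Or31.
have [cd|dc] := path_le_total ce de.
  by apply: Or33; apply/setIidPr => f; exact: path_le_trans.
by apply: Or32; apply/setIidPl => f; exact: path_le_trans.
Qed.

Lemma pathsim_measure_unique (R : realType)
    (m1 m2 : probability (bpathsim A X) R) :
  (forall c, m1 (upsim c) = m2 (upsim c)) ->
  forall U : set (bpathsim A X), measurable U -> m1 U = m2 U.
Proof.
move=> m12; pose G : set (set (bpathsim A X)) :=
  [set U | [\/ U = set0, U = [set: bpathsim A X] | exists c, U = upsim c]].
have oup c : open (upsim c : set (pathsim A X)).
  by rewrite pathsim_openE => d e; exact: path_le_trans.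
have Gm : G `<=` measurable.
  move=> _ [->|->|[c ->]] //.
  by apply: sub_sigma_algebra; exact: oup.
apply: (@measure_unique _ _ _ G (fun=> setT)) => //.
- apply/seteqP; split; last first.
    apply: smallest_sub => //.
    exact: (@sigma_algebra_measurable _ (bpathsim A X)).
  apply: smallest_sub => [|U oU]; first exact: smallest_sigma_algebra.
  (* An open set is the union of the up-sets of its elements, a countable union because there are
     countably many stutter classes. *)
  rewrite (_ : U = \bigcup_c (if c \in U then upsim c else set0)); last first.
    apply/seteqP; split=> [c Uc|d [c _]].
      by exists c => //; rewrite mem_set//; exact: path_le_refl.
    case: ifPn => // /set_mem Uc cd; rewrite pathsim_openE in oU.
    exact: oU Uc cd.
  apply: (@countable_bigcupT_measurable _ (g_sigma_algebraType G)).
    exact: countable_pathsim.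
  move=> c; apply: sub_sigma_algebra; case: ifP => _.
    by apply: Or33; exists c.
  exact: Or31.
- move=> _ V [->|->|[c ->]] GV; first by rewrite set0I; exact: Or31.
    by rewrite setTI.
  case: GV => [->|->|[d ->]]; first by rewrite setI0; exact: Or31.
    by rewrite setIT; apply: Or33; exists c.
  rewrite /G /=; have [->|->|->] := upsimI c d; first exact: Or31.
    by apply: Or33; exists c.
  by apply: Or33; exists d.
- by move=> _; exact: Or32.
- by rewrite bigcup_const.
- move=> _ [->|->|[c ->]]; last exact: m12; first by rewrite !measure0.
  by transitivity (1%E : \bar R); [|symmetry]; exact: probability_setT.
- move=> _; apply: (@le_lt_trans _ _ 1%E); first exact: probability_le1.
  exact: ltry.
Qed.

End countability.

(** Allows [distribution] to form the image of a probability under [pathsim_map f] as a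
    probability. *)
HB.instance Definition _ (A : choiceType) (X Y : pointedType) (f : X -> Y) :=
  @isMeasurableFun.Build _ _ (bpathsim A X) (bpathsim A Y) (pathsim_map f)
    (@measurable_pathsim_map A X Y f).

(** * From coalgebra morphisms to bisimulations and back *)

Section bisimulations.
Variables (R : realType) (A : choiceType) (X : pointedType) (P : fpts R A X).
Variables (mu : {measure set (bpath A X) -> \bar R}).
Hypothesis muP : is_path_measure P mu.

Lemma kernel_delay_bisimulation d (Y : measurableType d)
    (beta : Y -> pprobability (bpathsim A Y) R) (f : X -> Y) :
  (forall z (U : set (bpathsim A Y)), measurable U ->
    pushforward (alpha muP z) (pathsim_map f) U = beta (f z) U) ->
  delay_bisimulation P (fun z w => f z == f w).
Proof.
move=> fbeta; split; first by move=> z w u; split=> // /eqP ->.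
move=> z w /eqP zw y a; rewrite !reach_probE.
(* Stutter invariance of [hits] makes the event of reaching the class of [y] the inverse image of
   [V], so its probability from [u] depends on [f u] only. *)
pose V : set (bpathsim A Y) := [set c | hits a [set f y] (st (repr c))].
have oV : open (V : set (pathsim A Y)).
  by rewrite pathsim_openE => c e /= Vc ce; exact: hits_le ce.
suff E u : hit_weight P (hits a [set v | f y == f v]) u = beta (f u) V.
  by rewrite !E zw.
rewrite -fbeta; last exact: sub_sigma_algebra.
rewrite -(mu_up_path1 muP); last exact: open_hits.
rewrite /pushforward; congr (mu (_ `&` _)); apply/seteqP; split=> p.
  move=> Hp; rewrite /preimage /= pathsim_map_pi /V /= st_repr; apply/hits_st.
  by apply/hits_map; move: Hp => [s [sp Ls /eqP e]]; exists s.
rewrite /preimage /= pathsim_map_pi /V /= st_repr => /hits_st [s [sp Ls e]].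
by exists s; split=> //=; apply/eqP; rewrite -e.
Qed.

Section class_representatives.
Variable r : rel X.
Hypothesis rbisim : delay_bisimulation P r.

(** Related states have the same predicate [r x], hence the same chosen element, whatever the
    starting point of the choice within the class. *)
Definition canon (x : X) : X := choose (r x) x.

Lemma canonP x y : r x y = (canon x == canon y).
Proof.
have [req _] := rbisim; have rr z : r z z by have [] := req z z z.
have rcanon z : r z (canon z) by apply: chooseP.
have rE z w u : r z w -> r z u = r w u by have [_] := req z w u; apply.
apply/idP/eqP => [xy|e].
  rewrite /canon (@eq_choose _ (r x) (r y)); last by move=> u; exact: rE.
  by apply: choose_id => //; rewrite -(rE _ _ _ xy).
have yx : r y (canon x) by rewrite e.
by rewrite (rE _ _ _ (rcanon x)) -(rE _ _ _ yx).
Qed.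

Lemma canonK x : canon (canon x) = canon x.
Proof.
apply/esym/eqP; rewrite -canonP; apply: chooseP.
by have [req _] := rbisim; have [] := req x x x.
Qed.

Lemma prob_canon x x' a y : canon x = canon x' ->
  prob P (hits a (cls canon y)) x = prob P (hits a (cls canon y)) x'.
Proof.
move=> xx'; have [yy|/eqP yN] := eqVneq (canon y) y.
  have -> : cls canon y = [set z | r y z].
    apply/seteqP; split=> z; rewrite /cls /= canonP yy; first by move=> ->.
    by move/eqP.
  rewrite /prob -!reach_probE; congr fine; have [_] := rbisim; apply.
  by rewrite canonP xx'.
(* If [y] is not a representative, its fibre under [canon] is empty and both probabilities are 0. *)
have -> : cls canon y = set0.
  by apply/seteqP; split=> // z /= zy; apply: yN; rewrite -zy canonK.
have E u : prob P (hits a set0) u = 0.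
  by rewrite -[RHS](prob0 P u); apply: eq_prob => p _; split=> // -[s []].
by rewrite !E.
Qed.

Lemma pushforward_canon x x' : canon x = canon x' ->
  forall U : set (bpathsim A X), measurable U ->
  pushforward (alpha muP x) (pathsim_map canon) U =
  pushforward (alpha muP x') (pathsim_map canon) U.
Proof.
move=> xx'.
apply: (pathsim_measure_unique (fpts_states P) (fpts_actions P)
  (m1 := distribution (alpha muP x) (pathsim_map canon))
  (m2 := distribution (alpha muP x') (pathsim_map canon))) => c.
(* The representative of [c] may contain stutter steps, but only its stutter-free form enters
   [upsim c]. *)
have [q cE] : exists q, st (repr c) = st q by exists (repr c).
have E u : distribution (alpha muP u) (pathsim_map canon) (upsim c) =
    (prob P (above canon (st q)) u)%:E.
  rewrite (probE muP); last exact: open_above.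
  rewrite -(mu_up_path1 muP); last exact: open_above.
  rewrite /distribution /pushforward; congr (mu (_ `&` _)).
  apply/seteqP; split=> p; rewrite /preimage /= pathsim_map_pi /upsim /above /=;
    by rewrite /pathsim_le st_repr cE.
have [e eP] := prob_above_cls muP canonK prob_canon q.
transitivity ((prob P (above canon (st q)) x)%:E); first exact: E.
by rewrite eP xx' -eP; exact/esym/E.
Qed.

End class_representatives.
End bisimulations.

Theorem theorem51 (R : realType) (A : choiceType) (X : pointedType)
    (P : fpts R A X)
    (mu : {measure set (bpath A X) -> \bar R}) (muP : is_path_measure P mu)
    (x x' : X) :
  delay_bisimilar P x x' <->
  behav_equiv (X := discrete X) (alpha muP) x x'.
Proof.
split=> [[r rbisim rxx']|[d [Y [beta [f [_ _ fbeta fxx']]]]]]; last first.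
  exists (fun z w => f z == f w); last exact/eqP.
  exact: (kernel_delay_bisimulation (f := f) fbeta).
(* The quotient is realised on [X] itself through representatives. The morphism equation at [z]
   compares the image measures of [z] and [canon r z], two states of one class. *)
exists _, (discrete X), (fun y => distribution (alpha muP y)
  (pathsim_map (canon r)) : pprobability (bpathsim A (discrete X)) R),
  (canon r).
split.
- by move=> _ B _; exact: sub_sigma_algebra.
- by move=> _ B _; exact: sub_sigma_algebra.
- move=> z U mU; apply: (pushforward_canon muP rbisim) => //.
  by rewrite (canonK rbisim).
- by apply/eqP; rewrite -(canonP rbisim).
Qed.
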